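(* The chromatic symmetric function $X_{P_{n,\ell}}$ of the path $P_n$ twinned at the interior vertex $\ell$ satisfies, for $\ell\ge 2$, $n\ge\ell+1$ and $n\ge 4$, the $e$-positive recurrence $$X_{P_{n,\ell}}=\sum_{j=2}^{n-\ell-1}(j-1)e_jX_{P_{n-j,\ell}}+4(n+1)e_{n+1}+2n\,e_1e_n+2e_1\sum_{j=n-\ell+2}^{n-1}(j-1)e_jX_{P_{n-j}}$$ $$\qquad+4\sum_{j=n-\ell+3}^{n}(j-1)e_jX_{P_{n+1-j}}+2\sum_{j=n-\ell+1}^{n-\ell+2}(j-2)e_jX_{P_{n+1-j}}+(n-\ell-2)e_{n-\ell}X_{P_{\ell,\ell}}.$$ Thus, for $n\ge 3$ and $2\le\ell\le n-1$, $X_{P_{n,\ell}}$ is $e$-positive.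
   Context: The chromatic symmetric function of a finite simple graph $H=(V,E)$ is $X_H=\sum_\kappa\prod_{u\in V}x_{\kappa(u)}$, the sum over all proper colorings $\kappa:V\to\mathbb{Z}_{>0}$. $P_n$ is the path with vertices $1,2,\dots,n$ in order. The twin of a graph at a vertex $v$ is obtained by adding a new vertex $v'$ joined to $v$ and to all neighbors of $v$. $P_{n,\ell}$ denotes $P_n$ twinned at the vertex $\ell$; in particular $P_{\ell,\ell}$ is the path $P_\ell$ twinned at its leaf $\ell$. $e_i$ is the $i$-th elementary symmetric function; a symmetric function is $e$-positive if its expansion in the basis of elementary symmetric functions has nonnegative coefficients. Empty sums are zero. *)

(* Defs.v *)
From HB Require Import structures.
From mathcomp Require Import all_boot all_order all_algebra.
From mathcomp Require Import finmap multiset.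
From mathcomp Require Import boolp classical_sets functions cardinality fsbigop.

Set Implicit Arguments.
Unset Strict Implicit.
Unset Printing Implicit Defensive.

Import GRing.Theory.

Local Open Scope ring_scope.
Local Open Scope mset_scope.

(** * Formal power series over the integers in countably many variables *)

(* The monomial x_0^(m 0) x_1^(m 1) ... is the finite multiset [m].  The
   variables are indexed by [nat] instead of the positive integers. *)
Record mser := MSer { mcoef : {mset nat} -> int }.

Local Notation "f @_ m" := (mcoef f m%mset)
  (at level 3, m at level 2, format "f @_ m") : ring_scope.

HB.instance Definition _ := gen_eqMixin mser.
HB.instance Definition _ := gen_choiceMixin mser.

Lemma mserP (f g : mser) : (forall m, f@_m = g@_m) -> f = g.
Proof. by case: f => f; case: g => g fg; congr MSer; apply/funext. Qed.

(* All sub-multisets of [m], i.e. all monomial divisors, without repetition. *)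
Definition msubs (m : {mset nat}) : seq {mset nat} :=
  undup [seq seq_mset (mask t m) | t : (size m).-tuple bool].

Lemma msubs_uniq m : uniq (msubs m).
Proof. exact: undup_uniq. Qed.

Lemma mem_msubs (m a : {mset nat}) : (a \in msubs m) = (a `<=` m).
Proof.
rewrite mem_undup; apply/mapP/idP => [[t _ ->]|/msubsetP am].
  apply/msubsetP => x; rewrite mset_seqE -[m x]count_mem_mset.
  by rewrite leq_count_subseq // mask_subseq.
have /count_subseqP[s /subseqP[t szt ->] pt] :
    forall x, (count_mem x a <= count_mem x m)%N.
  by move=> x; rewrite !count_mem_mset.
move/eqP: szt => szt; exists (Tuple szt); first by rewrite mem_enum.
by rewrite -[LHS]seq_mset_id; apply/eq_seq_msetP.
Qed.

Definition mser0 : mser := MSer (fun=> 0).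
Definition mser1 : mser := MSer (fun m => (m == mset0)%:R).
Definition mser_opp (f : mser) : mser := MSer (fun m => - f@_m).
Definition mser_add (f g : mser) : mser := MSer (fun m => f@_m + g@_m).
Definition mser_mul (f g : mser) : mser :=
  MSer (fun m => \sum_(a <- msubs m) f@_a * g@_(m `\` a)).

Fact mser_addA : associative mser_add.
Proof. by move=> f g h; apply: mserP => m; rewrite /= addrA. Qed.
Fact mser_addC : commutative mser_add.
Proof. by move=> f g; apply: mserP => m; rewrite /= addrC. Qed.
Fact mser_add0 : left_id mser0 mser_add.
Proof. by move=> f; apply: mserP => m; rewrite /= add0r. Qed.
Fact mser_addN : left_inverse mser0 mser_opp mser_add.
Proof. by move=> f; apply: mserP => m; rewrite /= addNr. Qed.

HB.instance Definition _ :=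
  GRing.isZmodule.Build mser mser_addA mser_addC mser_add0 mser_addN.

Lemma msubs_rev m (F : {mset nat} -> {mset nat} -> int) :
  \sum_(a <- msubs m) F a (m `\` a) = \sum_(a <- msubs m) F (m `\` a) a.
Proof.
have pm : perm_eq (msubs m) [seq m `\` a | a <- msubs m].
  apply: uniq_perm; rewrite ?msubs_uniq //.
    rewrite map_inj_in_uniq ?msubs_uniq // => a b.
    by rewrite !mem_msubs => am bm eab; rewrite -(msetBBK am) eab msetBBK.
  move=> a; rewrite mem_msubs; apply/idP/mapP => [am|[b _ ->]].
    exists (m `\` a); rewrite ?msetBBK // mem_msubs.
    by apply/msubsetP => x; rewrite msetE2 leq_subr.
  by apply/msubsetP => x; rewrite msetE2 leq_subr.
rewrite (perm_big _ pm) big_map big_seq [RHS]big_seq /=.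
by apply: eq_bigr => a; rewrite mem_msubs => am; rewrite msetBBK.
Qed.

Lemma msubs_exchange m (F : {mset nat} -> {mset nat} -> int) :
  \sum_(b <- msubs m) \sum_(a <- msubs b) F a b =
  \sum_(a <- msubs m) \sum_(c <- msubs (m `\` a)) F a (a `+` c).
Proof.
transitivity (\sum_(b <- msubs m) \sum_(a <- msubs m | a `<=` b) F a b).
  rewrite big_seq [RHS]big_seq; apply: eq_bigr => b; rewrite mem_msubs => bm.
  rewrite -[RHS]big_filter; apply: perm_big; apply: uniq_perm.
  - exact: msubs_uniq.
  - exact/filter_uniq/msubs_uniq.
  move=> a; rewrite mem_filter !mem_msubs andb_idr // => ab.
  exact: msubset_trans bm.
rewrite (exchange_big_dep xpredT) //= big_seq [RHS]big_seq.
apply: eq_bigr => a; rewrite mem_msubs => am.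
rewrite -big_filter -(big_map (fun c => a `+` c) xpredT (F a)).
apply: perm_big; apply: uniq_perm.
- exact/filter_uniq/msubs_uniq.
- by rewrite (map_inj_uniq (can_inj (@msetDKB _ a))) msubs_uniq.
move=> b; rewrite mem_filter mem_msubs; apply/andP/mapP => [[ab bm]|[c]].
  by exists (b `\` a); rewrite ?msetBDKC // mem_msubs msetSB.
rewrite mem_msubs => cm ->; split.
  by apply/msubsetP => x; rewrite msetE2 leq_addr.
by rewrite -(msetBDKC am) msetDS.
Qed.

Fact mser_mulC : commutative mser_mul.
Proof.
move=> f g; apply: mserP => m /=; rewrite (msubs_rev m (fun a b => f@_a * g@_b)).
by apply: eq_bigr => a _; rewrite mulrC.
Qed.

Fact mser_mulA : associative mser_mul.
Proof.
move=> f g h; apply: mserP => m /=; symmetry.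
under eq_bigr do rewrite mulr_suml.
rewrite (msubs_exchange m (fun a b => f@_a * g@_(b `\` a) * h@_(m `\` b))).
apply: eq_bigr => a _; rewrite mulr_sumr; apply: eq_bigr => c _.
by rewrite msetDKB msetBDA mulrA.
Qed.

Fact mser_mul1 : left_id mser1 mser_mul.
Proof.
move=> f; apply: mserP => m /=.
rewrite (bigD1_seq mset0) ?msubs_uniq ?mem_msubs ?msub0set //= eqxx mul1r msetB0.
by rewrite big1 ?addr0 // => a /negPf ->; rewrite mul0r.
Qed.

Fact mser_mulDl : left_distributive mser_mul mser_add.
Proof.
move=> f g h; apply: mserP => m /=; rewrite -big_split.
by apply: eq_bigr => a _; rewrite mulrDl.
Qed.

Fact mser1_neq0 : mser1 != mser0.
Proof. by apply/eqP => /(congr1 (fun f => f@_mset0)) /=; rewrite eqxx. Qed.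

HB.instance Definition _ := GRing.Zmodule_isComNzRing.Build mser
  mser_mulA mser_mulC mser_mul1 mser_mulDl mser1_neq0.

Definition mvar (i : nat) : mser := MSer (fun m => (m == [mset i])%:R).

(* The possibly infinite sum of a family of series, coefficient by
   coefficient; it is meaningful when every monomial occurs in only finitely
   many members of the family (see [summable]). *)
Definition msum (I : choiceType) (A : set I) (F : I -> mser) : mser :=
  MSer (fun m => \sum_(i \in A) (F i)@_m).

Definition summable (I : choiceType) (A : set I) (F : I -> mser) : Prop :=
  forall m, finite_set [set i | A i /\ (F i)@_m <> 0].

(** * Elementary symmetric functions and e-positivity *)

Definition elemsym (k : nat) : mser :=
  msum [set S : {fset nat} | #|` S| = k] (fun S => \prod_(i <- S) mvar i).

Definition elemsym_part (la : seq nat) : mser := \prod_(i <- la) elemsym i.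

Definition is_part (la : seq nat) : bool := sorted geq la && (0%N \notin la).

Definition e_expansion (f : mser) (c : {fsfun seq nat -> int with 0}) : Prop :=
  {in finsupp c, forall la, is_part la} /\
  f = \sum_(la <- finsupp c) (c la)%:~R * elemsym_part la.

(* As the e_la form a basis of the symmetric functions, [c] is unique. *)
Definition e_positive (f : mser) : Prop :=
  exists2 c, e_expansion f c & forall la, 0 <= c la.

(** * Graphs and the chromatic symmetric function *)

Record sgraph := SGraph {
  vertex : finType;
  edge : rel vertex;
  edge_sym : symmetric edge;
  edge_irrefl : irreflexive edge }.

Definition proper_coloring (H : sgraph) (k : {ffun vertex H -> nat}) : Prop :=
  forall u v, edge u v -> k u <> k v.

Definition chromsym (H : sgraph) : mser :=
  msum [set k | proper_coloring k] (fun k => \prod_(u : vertex H) mvar (k u)).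

(* Vertex number i of the path (1 <= i <= n) is the ordinal i - 1. *)
Definition path_edge (n : nat) : rel 'I_n :=
  [rel i j : 'I_n | (i.+1 == j) || (j.+1 == i)].

Fact path_edge_sym n : symmetric (@path_edge n).
Proof. by move=> i j; rewrite /path_edge /= orbC. Qed.

Fact path_edge_irrefl n : irreflexive (@path_edge n).
Proof. by move=> i; rewrite /path_edge /= orbb gtn_eqF. Qed.

Definition path_graph (n : nat) : sgraph :=
  SGraph (@path_edge_sym n) (@path_edge_irrefl n).

(* [None] is the new vertex. *)
Definition twin_edge (H : sgraph) (v : vertex H) : rel (option (vertex H)) :=
  fun x y => match x, y with
  | Some a, Some b => edge a b
  | Some a, None | None, Some a => (a == v) || edge v a
  | None, None => false
  end.

Fact twin_edge_sym H v : symmetric (@twin_edge H v).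
Proof. by case=> [a|] [b|] //=; rewrite edge_sym. Qed.

Fact twin_edge_irrefl H v : irreflexive (@twin_edge H v).
Proof. by case=> [a|] //=; rewrite edge_irrefl. Qed.

Definition twin (H : sgraph) (v : vertex H) : sgraph :=
  SGraph (@twin_edge_sym H v) (@twin_edge_irrefl H v).

(* The path with n vertices twinned at its vertex number l, 1 <= l <= n (and
   the bare path for any other l). *)
Definition twinned_path (n l : nat) : sgraph :=
  if [pick v : 'I_n | v.+1 == l] is Some v then @twin (path_graph n) v
  else path_graph n.

(** * The infinite sums above are well defined *)

Lemma coef_prod_mvar (s : seq nat) m :
  (\prod_(i <- s) mvar i)@_m = (m == seq_mset s)%:R.
Proof.
elim: s m => [|i s IHs] m.
  rewrite big_nil /=; congr (nat_of_bool (m == _))%:R.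
  by apply/msetP => x; rewrite mset0E mset_seqE.
rewrite big_cons mset_cons /=; under eq_bigr do rewrite IHs.
have [im|nim] := boolP ([mset i] `<=` m).
  rewrite (bigD1_seq [mset i]) ?msubs_uniq ?mem_msubs //= eqxx mul1r.
  rewrite big1 ?addr0 => [|a /negPf ->]; last by rewrite mul0r.
  congr (nat_of_bool _)%:R; apply/eqP/eqP => [<-|->]; first by rewrite msetBDKC.
  by rewrite msetDKB.
rewrite big_seq big1 => [|a]; last first.
  rewrite mem_msubs => am; case: eqP => [ea|_]; last by rewrite mul0r.
  by rewrite -ea am in nim.
case: eqP => // em; case/negP: nim; rewrite em.
by apply/msubsetP => x; rewrite msetE2 leq_addr.
Qed.

Lemma summable_elemsym (k : nat) :
  summable [set S : {fset nat} | #|` S| = k] (fun S => \prod_(i <- S) mvar i).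
Proof.
move=> m; apply: (sub_finite_set _ (finite_fset (fpowerset (finsupp m)))).
move=> S /= [_]; rewrite coef_prod_mvar; case: eqP => // -> _.
rewrite fpowersetE; apply/fsubsetP => x xS.
by rewrite msuppE in_mset mset_seqE -has_count has_pred1.
Qed.

Lemma summable_chromsym (H : sgraph) :
  summable [set k : {ffun vertex H -> nat} | proper_coloring k]
    (fun k => \prod_(u : vertex H) mvar (k u)).
Proof.
move=> m.
pose ext (g : {ffun vertex H -> finsupp m}) : {ffun vertex H -> nat} :=
  [ffun u => val (g u)].
apply: (sub_finite_set _ (finite_image ext (@finite_finset _ setT))) => k /= [_].
rewrite -(big_map (fun u => k u) xpredT mvar) coef_prod_mvar.
case: eqP => // em _.
have km u : k u \in finsupp m.
  by rewrite msuppE in_mset em mset_seqE -has_count has_pred1 map_f ?mem_index_enum.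
exists [ffun u => [` km u]%fset] => //.
by apply/ffunP => u; rewrite !ffunE.
Qed.

(* Main.v *)
From HB Require Import structures.
Require Import Defs.
From mathcomp Require Import boolp classical_sets functions fsbigop.
From mathcomp Require Import all_boot all_order all_algebra.
From mathcomp Require Import finmap multiset ring zify.

Set Implicit Arguments.
Unset Strict Implicit.
Unset Printing Implicit Defensive.

Import GRing.Theory.

Local Open Scope ring_scope.

(** Restrict to finitely many colours and write P_n for the chromatic symmetric
    function of the path on n vertices, f_n(c) for its part in which the first
    vertex has colour c, and D_j(c) for the part of e_j whose monomials contain
    x_c.  Both families obey the same recursion,
      f_(n+1)(c) = x_c (P_n - f_n(c)),   D_(j+1)(c) = x_c (e_j - D_j(c)),
    with sum_c f_n(c) = P_n for n > 0 and sum_c D_j(c) = j e_j.  Playing the two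
    recursions against each other in sum_c f_n(c) D_j(c) telescopes to
      sum_(j = 0..n) (1 - j) e_j P_(n-j) = e_n,
    and in sum_c f_a(c) f_b(c) gives P_a P_b - P_(a+b).  A colouring of the path
    twinned at l consists of distinct colours c, d for the twins and of two
    shorter paths whose end colours avoid c and d, so with a = l - 1, b = n - l
    its generating function is
      sum_(c <> d) x_c x_d (P_a - f_a(c) - f_a(d)) (P_b - f_b(c) - f_b(d)),
    which the previous identities evaluate to the closed form [twin_form].  As a
    function of b, this is a linear combination of shifts of P, so convolving it
    with (1 - j) e_j for j < b leaves only the end terms of the convolution
    identity for P: this is the recurrence.  Its last coefficient n - l - 2 is
    negative only for l = n - 1; there positivity comes from the symmetry
    a <-> b of the closed form, which reduces to l = 2, and from the value
    16 e_4 + 2 e_3 e_1 for n = 3. *)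

(** * The closed form for twinned paths *)

Definition twin_form (R : comNzRingType) (E P : nat -> R) (a b : nat) : R :=
  4 * P (a + b).+2 + 2 * E 1 * P (a + b).+1 - 2 * P a.+1 * P b.+1
  - 2 * P a * P b.+2 - 2 * P a.+2 * P b + 2 * E 2 * P a * P b.

Section PathSequence.
Variables (R : comNzRingType) (E P : nat -> R).
Hypothesis E0 : E 0 = 1.
Hypothesis convEP : forall n,
  \sum_(0 <= j < n.+1) (1 - j%:R) * E j * P (n - j)%N = E n.

Local Notation T := (twin_form E P).

Lemma path_seq0 : P 0 = 1.
Proof. by have := convEP 0; rewrite big_nat1 E0 subr0 !mul1r. Qed.

Lemma path_seq1 : P 1 = E 1.
Proof. by rewrite -convEP !big_nat_recl // big_geq // E0; ring. Qed.

Definition trunc_conv (F : nat -> R) (n : nat) : R :=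
  \sum_(0 <= j < n) (1 - j%:R) * E j * F (n - j)%N.

Lemma trunc_conv_unfold F n : (0 < n)%N ->
  F n = \sum_(2 <= j < n) (j%:R - 1) * E j * F (n - j)%N + trunc_conv F n.
Proof.
case: n => [|[|n]] // _; rewrite /trunc_conv.
  by rewrite big_geq // big_nat1 E0; ring.
have opp_tail : \sum_(2 <= j < n.+2) (1 - j%:R) * E j * F (n.+2 - j)%N
    = - \sum_(2 <= j < n.+2) (j%:R - 1) * E j * F (n.+2 - j)%N.
  by rewrite -sumrN; apply: eq_bigr => j _; ring.
by rewrite [in X in _ + X]big_ltn // [in X in _ + X]big_ltn // opp_tail E0; ring.
Qed.

Lemma trunc_conv_path n : trunc_conv P n = n%:R * E n.
Proof.
have := convEP n; rewrite big_nat_recr //= subnn path_seq0 mulr1.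
rewrite -/(trunc_conv P n) => conv_n.
by rewrite -[LHS](addrK ((1 - n%:R) * E n)) conv_n; ring.
Qed.

Lemma path_seq_rec n : (0 < n)%N ->
  P n = \sum_(2 <= j < n) (j%:R - 1) * E j * P (n - j)%N + n%:R * E n.
Proof. by move=> n0; rewrite -trunc_conv_path -trunc_conv_unfold. Qed.

Lemma path_seq2 : P 2 = 2 * E 2.
Proof. by rewrite path_seq_rec // big_geq // add0r. Qed.

Local Notation shift k := (fun i => P (k + i)%N).

Lemma trunc_conv_shiftS k n :
  trunc_conv (shift k.+1) n = (n%:R - 1) * E n * P k.+1 + trunc_conv (shift k) n.+1.
Proof.
rewrite /trunc_conv big_nat_recr //= subSnn addn1 addrCA -mulrDl -mulrDl.
rewrite (_ : n%:R - 1 + (1 - n%:R) = 0); last by ring.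
rewrite !mul0r addr0; apply: eq_big_nat => j /andP[_ jn].
by rewrite addSnnS subSn // ltnW.
Qed.

Lemma trunc_conv_shift k n :
  trunc_conv (shift k) n
  = \sum_(n <= j < k + n) (j%:R - 1) * E j * P (k + n - j)%N
    + (k + n)%:R * E (k + n).
Proof.
elim: k n => [|k IHk] n; first by rewrite add0n big_geq // add0r trunc_conv_path.
rewrite trunc_conv_shiftS IHk addrA addSnnS [in RHS]big_ltn ?addnS ?ltnS ?leq_addl //.
by rewrite -addSn addnK.
Qed.

Lemma trunc_conv_twin_form a n :
  trunc_conv (T a) n
  = 4 * trunc_conv (shift a.+2) n + 2 * E 1 * trunc_conv (shift a.+1) n
    - 2 * P a.+1 * trunc_conv (shift 1) n - 2 * P a * trunc_conv (shift 2) n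
    - 2 * P a.+2 * trunc_conv (shift 0) n + 2 * E 2 * P a * trunc_conv (shift 0) n.
Proof.
rewrite /trunc_conv !mulr_sumr -!sumrN -!big_split /=.
by apply: eq_bigr => j _; rewrite /twin_form !addSn !add0n; ring.
Qed.

Lemma twin_formC a b : T a b = T b a.
Proof. by rewrite /twin_form addnC; ring. Qed.

Lemma twin_form0 a : T a 0 = 2 * P a.+2 - 2 * E 2 * P a.
Proof. by rewrite /twin_form addn0 path_seq0 path_seq1 path_seq2; ring. Qed.

Lemma twin_form_rec a b : (0 < a)%N -> (0 < b)%N ->
  T a b = \sum_(2 <= j < b) (j%:R - 1) * E j * T a (b - j)
    + 4 * (a + b).+2%:R * E (a + b).+2
    + 2 * (a + b).+1%:R * E 1 * E (a + b).+1
    + 2 * E 1 * \sum_(b.+2 <= j < (a + b).+1) (j%:R - 1) * E j * P ((a + b).+1 - j)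
    + 4 * \sum_(b.+3 <= j < (a + b).+2) (j%:R - 1) * E j * P ((a + b).+2 - j)
    + 2 * \sum_(b.+1 <= j < b.+3) (j%:R - 2) * E j * P ((a + b).+2 - j)
    + (b%:R - 2) * E b * T a 0.
Proof.
case: a => // a _ b0; rewrite [LHS](trunc_conv_unfold (T a.+1)) // -!addrA.
congr (_ + _); rewrite trunc_conv_twin_form !trunc_conv_shiftS trunc_conv_path.
rewrite !trunc_conv_shift twin_form0 path_seq1 path_seq2.
rewrite [\sum_(b.+1 <= _ < _) _]big_ltn // big_nat1.
rewrite !addnS !add0n !addSn !(big_geq (leqnn _)).
rewrite (_ : (a + b).+3 - b.+1 = a.+2)%N; last by lia.
rewrite (_ : (a + b).+3 - b.+2 = a.+1)%N; last by lia.
by ring.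
Qed.

Section SemiringMembership.
Variable S : semiringClosed R.
Hypothesis E_S : forall j, (0 < j)%N -> E j \in S.

Lemma weighted_sum_mem i m n (F : nat -> R) : (0 < m)%N -> (i <= m)%N ->
  (forall j, (m <= j < n)%N -> F j \in S) ->
  \sum_(m <= j < n) (j%:R - i%:R) * E j * F j \in S.
Proof.
move=> m0 im FS; rewrite big_nat; apply: rpred_sum => j jmn.
have [mj _] := andP jmn; rewrite rpredM ?FS // rpredM ?E_S ?(leq_trans m0) //.
by rewrite -natrB ?(leq_trans im) // rpred_nat.
Qed.

Lemma path_seq_mem n : P n \in S.
Proof.
elim/ltn_ind: n => -[|n] IHn; first by rewrite path_seq0 rpred1.
rewrite path_seq_rec // rpredD ?rpredM ?rpred_nat ?E_S //.
by apply: (weighted_sum_mem (i := 1)) => // j jn; apply: IHn; lia.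
Qed.

Lemma twin_form0_mem a : (0 < a)%N -> T a 0 \in S.
Proof.
move=> a0; rewrite twin_form0 path_seq_rec // big_ltn // !subSS subn0.
set tail := \sum_(3 <= j < a.+2) _.
rewrite (_ : _ - _ = 2 * (tail + a.+2%:R * E a.+2)); last by ring.
rewrite rpredM ?rpred_nat // rpredD ?rpredM ?rpred_nat ?E_S //.
by apply: (weighted_sum_mem (i := 1)) => // j _; exact: path_seq_mem.
Qed.

Lemma twin_form_mem_step a b : (0 < a)%N -> (1 < b)%N ->
  (forall i, (0 < i < b)%N -> T a i \in S) -> T a b \in S.
Proof.
move=> a0 b1 T_S; have b0 := ltnW b1.
rewrite twin_form_rec // !rpredD ?rpredM ?rpred_nat ?E_S //.
- by apply: (weighted_sum_mem (i := 1)) => // j jb; apply: T_S; lia.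
- by apply: (weighted_sum_mem (i := 1)) => // j _; exact: path_seq_mem.
- by apply: (weighted_sum_mem (i := 1)) => // j _; exact: path_seq_mem.
- by apply: (weighted_sum_mem (i := 2)) => // j _; exact: path_seq_mem.
- by rewrite -natrB // rpred_nat.
- exact: twin_form0_mem.
Qed.

Lemma twin_form11 : T 1 1 = 16 * E 4 + 2 * E 1 * E 3.
Proof.
rewrite /twin_form (path_seq_rec (n := 4)) // (path_seq_rec (n := 3)) //.
rewrite big_ltn // !big_nat1 path_seq1 path_seq2.
by ring.
Qed.

Lemma twin_form_mem a b : (0 < a)%N -> (0 < b)%N -> T a b \in S.
Proof.
move En: (a + b)%N => n; elim/ltn_ind: n a b En => n IHn a b En a0 b0.
have mem_step c d : (c + d)%N = n -> (0 < c)%N -> (1 < d)%N -> T c d \in S.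
  by move=> cd c0 d1; apply: twin_form_mem_step => // i ?; apply: (IHn (c + i)%N); lia.
have [b1|b1] := ltnP 1 b; first exact: mem_step.
have [a1|a1] := ltnP 1 a; first by rewrite twin_formC; apply: mem_step; lia.
have [-> ->] : a = 1%N /\ b = 1%N by lia.
by rewrite twin_form11 rpredD ?rpredM ?rpred_nat ?E_S.
Qed.

End SemiringMembership.

End PathSequence.

(** * Path and twin colourings with finitely many colours *)

Section BigTuple.
Variables (R : Type) (idx : R) (op : Monoid.com_law idx) (T : finType).

Lemma big_tuple0 (F : 0.-tuple T -> R) :
  \big[op/idx]_(t : 0.-tuple T) F t = F [tuple].
Proof. by apply: big_pred1 => t; apply/esym/eqP; exact: tuple0. Qed.

Lemma big_tuple_cat m n (F : (m + n).-tuple T -> R) :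
  \big[op/idx]_(t : (m + n).-tuple T) F t
  = \big[op/idx]_(u : m.-tuple T) \big[op/idx]_(v : n.-tuple T) F [tuple of u ++ v].
Proof.
pose cat_pair (p : m.-tuple T * n.-tuple T) := [tuple of p.1 ++ p.2].
rewrite pair_bigA (reindex cat_pair) //; apply: onW_bij; apply: inj_card_bij.
  move=> [u v] [u' v'] /(congr1 val) /eqP /=.
  by rewrite eqseq_cat ?size_tuple // => /andP[/eqP/val_inj -> /eqP/val_inj ->].
by rewrite card_prod !card_tuple expnD.
Qed.

Lemma big_tupleS n (F : n.+1.-tuple T -> R) :
  \big[op/idx]_(t : n.+1.-tuple T) F t
  = \big[op/idx]_c \big[op/idx]_(t : n.-tuple T) F [tuple of c :: t].
Proof.
pose cons_pair (p : T * n.-tuple T) := [tuple of p.1 :: p.2].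
rewrite pair_bigA (reindex cons_pair) //; apply: onW_bij; apply: inj_card_bij.
  by move=> [c t] [c' t'] /(congr1 val) [-> /val_inj ->].
by rewrite card_prod !card_tuple expnS.
Qed.

Lemma big_tuple_rev n (F : n.-tuple T -> R) :
  \big[op/idx]_(t : n.-tuple T) F t = \big[op/idx]_(t : n.-tuple T) F [tuple of rev t].
Proof.
apply: (reindex_inj (h := fun t : n.-tuple T => [tuple of rev t])).
by move=> t t' /(congr1 val) /(can_inj revK) /val_inj.
Qed.

Lemma big_finfun_tuple n (F : {ffun 'I_n -> T} -> R) :
  \big[op/idx]_(f : {ffun 'I_n -> T}) F f
  = \big[op/idx]_(t : n.-tuple T) F (finfun_of_tuple t).
Proof.
apply: reindex; apply: onW_bij.
exact: Bijective finfun_of_tupleK tuple_of_finfunK.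
Qed.

(* [u] is read outwards from the centre [c], like [w]. *)
Definition tuple_around m n (u : m.-tuple T) (c : T) (w : n.-tuple T) :
  (m + n.+1).-tuple T := [tuple of rev u ++ c :: w].

Lemma big_finfun_around m n (F : {ffun 'I_(m + n.+1) -> T} -> R) :
  \big[op/idx]_(f : {ffun 'I_(m + n.+1) -> T}) F f
  = \big[op/idx]_c \big[op/idx]_(u : m.-tuple T) \big[op/idx]_(w : n.-tuple T)
      F (finfun_of_tuple (tuple_around u c w)).
Proof.
rewrite big_finfun_tuple big_tuple_cat big_tuple_rev exchange_big /=.
by rewrite big_tupleS; apply: eq_bigr => c _; rewrite exchange_big.
Qed.

End BigTuple.

Lemma sum_offdiag (V : zmodType) (I : finType) (F : I -> I -> V) :
  \sum_i \sum_(j | i != j) F i j = \sum_i \sum_j F i j - \sum_i F i i.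
Proof.
rewrite -sumrB; apply: eq_bigr => i _; rewrite [in RHS](bigD1 i) //= addrAC subrr add0r.
by apply: eq_bigl => j; rewrite eq_sym.
Qed.

Section FiniteColours.
Variables (R : comNzRingType) (C : finType) (x : C -> R).

Definition fin_elemsym (k : nat) : R :=
  \sum_(S : {set C} | #|S| == k) \prod_(c in S) x c.

Definition fin_elemsym_at (k : nat) (c : C) : R :=
  \sum_(S : {set C} | (#|S| == k) && (c \in S)) \prod_(d in S) x d.

Lemma fin_elemsym0 : fin_elemsym 0 = 1.
Proof.
rewrite /fin_elemsym (big_pred1 set0) ?big_set0 // => S.
by rewrite cards_eq0.
Qed.

Lemma fin_elemsym_at0 c : fin_elemsym_at 0 c = 0.
Proof.
rewrite /fin_elemsym_at big_pred0 // => S; rewrite cards_eq0.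
by apply/negP => /andP[/eqP ->]; rewrite inE.
Qed.

Lemma fin_elemsym_atS k c :
  fin_elemsym_at k.+1 c = x c * (fin_elemsym k - fin_elemsym_at k c).
Proof.
rewrite /fin_elemsym (bigID (fun S : {set C} => c \in S)) /= addrC addrK mulr_sumr.
rewrite /fin_elemsym_at (reindex_onto (fun S => c |: S) (fun S => S :\ c)) /=; last first.
  by move=> S /andP[_]; exact: setD1K.
have setU1D1 (S : {set C}) : ((c |: S) :\ c == S) = (c \notin S).
  by apply/eqP/idP => [<-|]; [rewrite setD11 | exact: setU1K].
apply: eq_big => [S|S]; rewrite setU1D1; last by move=> /andP[_ cS]; rewrite big_setU1.
by rewrite setU11 andbT cardsU1; case: (c \in S); rewrite ?andbF ?andbT.
Qed.

Lemma sum_fin_elemsym_at k : \sum_c fin_elemsym_at k c = k%:R * fin_elemsym k.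
Proof.
rewrite /fin_elemsym_at (exchange_big_dep (fun S : {set C} => #|S| == k)) /=.
  rewrite mulr_sumr; apply: eq_bigr => S /eqP <-.
  rewrite (eq_bigl (fun c => c \in S)) => [|c]; last by rewrite eqxx.
  by rewrite sumr_const mulr_natl.
by move=> c S _ /andP[].
Qed.

Lemma fin_elemsym1 : fin_elemsym 1 = \sum_c x c.
Proof.
rewrite -[LHS]mul1r -(sum_fin_elemsym_at 1); apply: eq_bigr => c _.
by rewrite fin_elemsym_atS fin_elemsym0 fin_elemsym_at0 subr0 mulr1.
Qed.

Local Notation neq := (fun c d : C => c != d).

Definition path_sum n : R := \sum_(t : n.-tuple C | sorted neq t) \prod_(c <- t) x c.

Definition path_sum_from n c : R :=
  \sum_(t : n.-tuple C | sorted neq t && (ohead t == Some c)) \prod_(d <- t) x d.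

Lemma path_sum0 : path_sum 0 = 1.
Proof. by rewrite /path_sum big_mkcond big_tuple0 /= big_nil. Qed.

Lemma path_sum_from0 c : path_sum_from 0 c = 0.
Proof. by rewrite /path_sum_from big_mkcond big_tuple0. Qed.

Lemma path_sum_avoid n c :
  \sum_(t : n.-tuple C | path neq c t) \prod_(d <- t) x d
  = path_sum n - path_sum_from n c.
Proof.
rewrite /path_sum [in RHS](bigID (fun t : n.-tuple C => ohead t == Some c)) /=.
rewrite [X in X - _]addrC addrK; apply: eq_bigl => -[[|d s] _] //=.
by rewrite andbC (inj_eq Some_inj) eq_sym.
Qed.

Lemma path_sum_avoid2 n c d : c != d ->
  \sum_(t : n.-tuple C | path neq c t && path neq d t) \prod_(e <- t) x e
  = path_sum n - path_sum_from n c - path_sum_from n d.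
Proof.
move=> cd; rewrite -path_sum_avoid [in RHS](bigID (fun t : n.-tuple C => path neq d t)) /=.
rewrite [X in _ + X - _](_ : _ = path_sum_from n d) ?addrK //.
apply: eq_bigl => -[[|e s] _] //=.
have [->|ed] := eqVneq e d; first by rewrite cd eqxx andbT.
rewrite (inj_eq Some_inj) (negPf ed) /=.
by case: (path _ e s); rewrite ?andbF.
Qed.

Lemma path_sum_fromS n c :
  path_sum_from n.+1 c = x c * (path_sum n - path_sum_from n c).
Proof.
rewrite -path_sum_avoid /path_sum_from big_mkcond big_tupleS (bigD1 c) //=.
rewrite [X in _ + X]big1 ?addr0 => [|d dc].
  rewrite mulr_sumr [RHS]big_mkcond; apply: eq_bigr => t _.
  by rewrite eqxx andbT big_cons.
by rewrite big1 // => t _; rewrite (inj_eq Some_inj) (negPf dc) andbF.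
Qed.

Lemma sum_path_sum_fromS n : \sum_c path_sum_from n.+1 c = path_sum n.+1.
Proof.
rewrite /path_sum [RHS]big_mkcond big_tupleS; apply: eq_bigr => c _.
rewrite path_sum_fromS -path_sum_avoid mulr_sumr big_mkcond.
by apply: eq_bigr => t _; rewrite /= big_cons.
Qed.

Lemma path_sum1 : path_sum 1 = fin_elemsym 1.
Proof.
rewrite fin_elemsym1 -sum_path_sum_fromS; apply: eq_bigr => c _.
by rewrite path_sum_fromS path_sum0 path_sum_from0 subr0 mulr1.
Qed.

Lemma sum_mul_path_sum_from n :
  \sum_c x c * path_sum_from n c = fin_elemsym 1 * path_sum n - path_sum n.+1.
Proof.
rewrite fin_elemsym1 -sum_path_sum_fromS mulr_suml -sumrB.
by apply: eq_bigr => c _; rewrite path_sum_fromS; ring.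
Qed.

Lemma sum_mul_fin_elemsym_at n :
  \sum_c x c * fin_elemsym_at n c
  = fin_elemsym 1 * fin_elemsym n - n.+1%:R * fin_elemsym n.+1.
Proof.
rewrite fin_elemsym1 -sum_fin_elemsym_at mulr_suml -sumrB.
by apply: eq_bigr => c _; rewrite fin_elemsym_atS; ring.
Qed.

Lemma sum_path_sum_fromM a b :
  \sum_c path_sum_from a c * path_sum_from b c
  = path_sum a * path_sum b - path_sum (a + b).
Proof.
elim: a b => [|a IHa] b.
  rewrite big1 => [|c _]; last by rewrite path_sum_from0 mul0r.
  by rewrite path_sum0 mul1r subrr.
transitivity (\sum_c path_sum_from a c * path_sum_from b.+1 c
    + path_sum a * (\sum_c x c * path_sum_from b c)
    - path_sum b * (\sum_c x c * path_sum_from a c)).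
  rewrite !mulr_sumr -big_split -sumrB; apply: eq_bigr => c _ /=.
  by rewrite !path_sum_fromS; ring.
by rewrite IHa !sum_mul_path_sum_from addSnnS; ring.
Qed.

Lemma path_sum_conv n :
  \sum_(0 <= j < n.+1) (1 - j%:R) * fin_elemsym j * path_sum (n - j) = fin_elemsym n.
Proof.
pose cross j m := \sum_c path_sum_from m c * fin_elemsym_at j c.
have cross_step j m : cross j m.+1 - cross j.+1 m
    = fin_elemsym j * path_sum m.+1 - j.+1%:R * fin_elemsym j.+1 * path_sum m.
  transitivity (path_sum m * (\sum_c x c * fin_elemsym_at j c)
      - fin_elemsym j * (\sum_c x c * path_sum_from m c)).
    rewrite !mulr_sumr -!sumrB; apply: eq_bigr => c _.
    by rewrite path_sum_fromS fin_elemsym_atS; ring.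
  by rewrite sum_mul_path_sum_from sum_mul_fin_elemsym_at; ring.
have telescope : \sum_(0 <= j < n) (fin_elemsym j * path_sum (n - j)
    - j.+1%:R * fin_elemsym j.+1 * path_sum (n - j.+1)) = 0.
  rewrite (@telescope_sumr_eq _ _ _ (fun j => - cross j (n - j)%N)) // => [|j /andP[_ jn]].
    rewrite subnn subn0 /cross !big1 ?subrr // => c _.
      by rewrite fin_elemsym_at0 mulr0.
    by rewrite path_sum_from0 mul0r.
  by rewrite -(subnSK jn) -cross_step opprK addrC.
transitivity (\sum_(0 <= j < n.+1) fin_elemsym j * path_sum (n - j)
    - \sum_(0 <= j < n.+1) j%:R * fin_elemsym j * path_sum (n - j)).
  by rewrite -sumrB; apply: eq_bigr => j _; ring.
rewrite big_nat_recr //= [X in _ - X]big_nat_recl // subnn path_sum0.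
by move: telescope; rewrite sumrB => /eqP; rewrite subr_eq0 => /eqP ->; ring.
Qed.

Lemma sum_twin_product (f g : C -> R) (p q : R) :
  \sum_c \sum_d x c * x d * ((p - f c - f d) * (q - g c - g d))
  = (\sum_c x c) * (p * q * (\sum_c x c) - 2 * p * (\sum_c x c * g c)
      - 2 * q * (\sum_c x c * f c) + 2 * (\sum_c x c * f c * g c))
    + 2 * (\sum_c x c * f c) * (\sum_c x c * g c).
Proof.
have distr (u v : C -> R) : (\sum_c u c) * (\sum_c v c) = \sum_c \sum_d u c * v d.
  exact: big_distrlr.
transitivity (p * q * ((\sum_c x c) * (\sum_c x c))
    - p * ((\sum_c x c) * (\sum_c x c * g c) + (\sum_c x c * g c) * (\sum_c x c))
    - q * ((\sum_c x c) * (\sum_c x c * f c) + (\sum_c x c * f c) * (\sum_c x c))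
    + ((\sum_c x c) * (\sum_c x c * f c * g c) + (\sum_c x c * f c * g c) * (\sum_c x c))
    + ((\sum_c x c * f c) * (\sum_c x c * g c)
       + (\sum_c x c * g c) * (\sum_c x c * f c))).
  rewrite !distr -!big_split !mulr_sumr -!sumrN -!big_split; apply: eq_bigr => c _ /=.
  rewrite -!big_split !mulr_sumr -!sumrN -!big_split; apply: eq_bigr => d _ /=.
  by ring.
by ring.
Qed.

Lemma sum_twin_product_diag (f f' g g' : C -> R) (p q : R) :
  (forall c, f' c = x c * (p - f c)) -> (forall c, g' c = x c * (q - g c)) ->
  \sum_c x c * x c * ((p - f c - f c) * (q - g c - g c))
  = 4 * (\sum_c f' c * g' c) - 2 * p * (\sum_c x c * g' c)
    - 2 * q * (\sum_c x c * f' c) + p * q * (\sum_c x c * x c).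
Proof.
move=> f'E g'E; rewrite !mulr_sumr -!sumrB -big_split; apply: eq_bigr => c _ /=.
by rewrite f'E g'E; ring.
Qed.

Lemma sum_twin_colours a b :
  \sum_c \sum_(d | c != d) x c * x d *
    ((path_sum a - path_sum_from a c - path_sum_from a d) *
     (path_sum b - path_sum_from b c - path_sum_from b d))
  = twin_form fin_elemsym path_sum a b.
Proof.
have path_sum2 : path_sum 2 = 2 * fin_elemsym 2.
  exact: path_seq2 fin_elemsym0 path_sum_conv.
rewrite sum_offdiag sum_twin_product.
have sum_xff : \sum_c x c * path_sum_from a c * path_sum_from b c
    = path_sum a * (\sum_c x c * path_sum_from b c)
      - \sum_c path_sum_from a.+1 c * path_sum_from b c.
  by rewrite mulr_sumr -sumrB; apply: eq_bigr => c _; rewrite path_sum_fromS; ring.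
have sum_xx : \sum_c x c * x c = fin_elemsym 1 * fin_elemsym 1 - path_sum 2.
  rewrite -[in X in _ * X - _]path_sum1 -sum_mul_path_sum_from; apply: eq_bigr => c _.
  by rewrite path_sum_fromS path_sum0 path_sum_from0 subr0 mulr1.
rewrite (sum_twin_product_diag (path_sum_fromS a) (path_sum_fromS b)).
rewrite sum_xff sum_xx !sum_mul_path_sum_from !sum_path_sum_fromM -fin_elemsym1.
by rewrite path_sum2 /twin_form addnS !addSn; ring.
Qed.

Definition is_proper (H : sgraph) (k : {ffun vertex H -> C}) : bool :=
  [forall u, forall v, edge u v ==> (k u != k v)].

Lemma is_properP (H : sgraph) (k : {ffun vertex H -> C}) :
  reflect (forall u v, edge u v -> k u != k v) (is_proper k).
Proof.
apply: (iffP forallP) => kp u; last by apply/forallP => v; apply/implyP/kp.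
by move=> v; exact/implyP/(forallP (kp u)).
Qed.

Definition fin_chromsym (H : sgraph) : R :=
  \sum_(k : {ffun vertex H -> C} | is_proper k) \prod_u x (k u).

Lemma prod_finfun_of_tuple n (t : n.-tuple C) :
  \prod_i x (finfun_of_tuple t i) = \prod_(c <- t) x c.
Proof. by rewrite big_tuple; apply: eq_bigr => i _; rewrite ffunE. Qed.

Lemma is_proper_path n (t : n.-tuple C) :
  @is_proper (path_graph n) (finfun_of_tuple t) = sorted neq t.
Proof.
case: n t => [|n] t; first by rewrite (tuple0 t); apply/is_properP => -[].
apply/is_properP/(sortedP (thead t)) => [kp i|ts u v].
  rewrite size_tuple => iS.
  have := kp (Ordinal (ltnW iS)) (Ordinal iS).
  by rewrite !ffunE !(tnth_nth (thead t)); apply; rewrite /= /path_edge /= eqxx.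
have step (i j : 'I_n.+1) : i.+1 = j -> tnth t i != tnth t j.
  move=> ij; rewrite !(tnth_nth (thead t)) -ij; apply: ts.
  by rewrite size_tuple ij.
by rewrite !ffunE => /orP[/eqP /step //|/eqP /step]; rewrite eq_sym.
Qed.

Lemma fin_chromsym_path n : fin_chromsym (path_graph n) = path_sum n.
Proof.
rewrite /fin_chromsym /path_sum big_mkcond [RHS]big_mkcond big_finfun_tuple.
by apply: eq_bigr => t _; rewrite is_proper_path prod_finfun_of_tuple.
Qed.

Definition recolour (V : finType) (v : V) (d : C) (k : {ffun V -> C}) : {ffun V -> C} :=
  [ffun u => if u == v then d else k u].

Lemma is_proper_twin (H : sgraph) (v : vertex H) (d : C) (k : {ffun vertex H -> C}) :
  @is_proper (twin v) [ffun o => if o is Some u then k u else d]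
  = [&& d != k v, is_proper k & is_proper (recolour v d k)].
Proof.
apply/is_properP/and3P => [k_proper|[dv /is_properP k_proper /is_properP recol_proper]].
  have k_edge u u' : edge u u' -> k u != k u'.
    by move=> e; have := k_proper (Some u) (Some u') e; rewrite !ffunE.
  have d_nbr u : (u == v) || edge v u -> d != k u.
    by move=> e; have := k_proper None (Some u) e; rewrite !ffunE.
  split; [by rewrite d_nbr ?eqxx | exact/is_properP |].
  apply/is_properP => u u'; rewrite !ffunE.
  have [->|uv] := eqVneq u v; have [->|u'v] := eqVneq u' v => e.
  - by rewrite edge_irrefl in e.
  - by rewrite d_nbr // e orbT.
  - by rewrite eq_sym d_nbr // edge_sym e orbT.
  - exact: k_edge.
have d_nbr u : (u == v) || edge v u -> d != k u.
  case/orP => [/eqP -> //|e]; have := recol_proper v u e; rewrite !ffunE eqxx.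
  by have [uv|//] := eqVneq u v; rewrite uv edge_irrefl in e.
move=> [u|] [u'|] //= e; rewrite !ffunE; last by rewrite d_nbr.
  exact: k_proper.
by rewrite eq_sym d_nbr.
Qed.

Lemma fin_chromsym_twin (H : sgraph) (v : vertex H) :
  fin_chromsym (twin v) = \sum_d \sum_(k : {ffun vertex H -> C} |
      [&& d != k v, is_proper k & is_proper (recolour v d k)])
    x d * \prod_u x (k u).
Proof.
rewrite pair_big_dep /= /fin_chromsym.
pose extend (p : C * {ffun vertex H -> C}) : {ffun option (vertex H) -> C} :=
  [ffun o => if o is Some u then p.2 u else p.1].
pose restrict (k : {ffun option (vertex H) -> C}) :=
  (k None, [ffun u => k (Some u)]).
have extendK : cancel extend restrict.
  by move=> [d k]; rewrite /restrict ffunE; congr pair; apply/ffunP => u; rewrite !ffunE.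
have restrictK : cancel restrict extend.
  by move=> k; apply/ffunP => -[u|]; rewrite !ffunE.
rewrite (reindex extend); last exact: onW_bij (Bijective extendK restrictK).
apply: eq_big => [[d k]|[d k] _]; first exact: is_proper_twin.
rewrite (bigD1 None) //= ffunE /=; congr (_ * _).
rewrite (reindex_omap Some id) => [|[]//]; apply: eq_big => [u|u _].
  by rewrite eqxx.
by rewrite ffunE.
Qed.

Lemma sorted_rev_cons c (s t : seq C) :
  sorted neq (rev s ++ c :: t) = path neq c s && path neq c t.
Proof.
rewrite sorted_cat_cons -rev_cons rev_sorted /=; congr (_ && _).
by apply: eq_path => d e; rewrite eq_sym.
Qed.

Lemma recolour_around a b (u : a.-tuple C) c d (w : b.-tuple C) (v : 'I_(a + b.+1)) :
  v = a :> nat ->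
  recolour v d (finfun_of_tuple (tuple_around u c w))
  = finfun_of_tuple (tuple_around u d w).
Proof.
move=> va; apply/ffunP => i; rewrite !ffunE -val_eqE /= va !(tnth_nth d) /=.
rewrite !nth_cat size_rev size_tuple.
by case: ltngtP => [//|ai|->]; rewrite ?subnn // -(subnSK ai).
Qed.

Lemma fin_chromsym_twin_path a b (v : 'I_(a + b.+1)) : v = a :> nat ->
  @fin_chromsym (@twin (path_graph (a + b.+1)) v) = twin_form fin_elemsym path_sum a b.
Proof.
move=> va; rewrite fin_chromsym_twin -sum_twin_colours.
rewrite [RHS](exchange_big_dep xpredT) //=; apply: eq_bigr => d _.
rewrite big_mkcond big_finfun_around [RHS]big_mkcond; apply: eq_bigr => c _.
have colour_v (u : a.-tuple C) (w : b.-tuple C) :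
    finfun_of_tuple (tuple_around u c w) v = c.
  by rewrite ffunE (tnth_nth c) va nth_cat size_rev size_tuple ltnn subnn.
under eq_bigr => u _ do under eq_bigr => w _ do
  rewrite colour_v recolour_around // !is_proper_path prod_finfun_of_tuple eq_sym.
case: (eqVneq c d) => [_|cd] /=; first by rewrite big1 // => u _; rewrite big1.
rewrite -!path_sum_avoid2 // big_distrlr mulr_sumr [RHS]big_mkcond /=.
apply: eq_bigr => u _; under eq_bigr => w _ do
  rewrite !sorted_rev_cons andbACA big_cat big_cons (perm_big u) ?perm_rev //=.
case: (_ && _) => /=; last by rewrite big1.
rewrite mulr_sumr [RHS]big_mkcond; apply: eq_bigr => w _.
by case: ifP => // _; ring.
Qed.

End FiniteColours.

(** * Truncation to finitely many variables *)

Lemma mcoef_sum (I : finType) (Q : pred I) (F : I -> mser) m :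
  mcoef (\sum_(i | Q i) F i) m = \sum_(i | Q i) mcoef (F i) m.
Proof. by apply: (big_morph (mcoef^~ m)). Qed.

Definition below (N : nat) (m : {mset nat}%mset) : bool := all (gtn N) m.

Lemma below_add N (a b : {mset nat}%mset) :
  below N (msetD a b) = below N a && below N b.
Proof.
apply/allP/andP => [abN|[/allP aN /allP bN] i].
  by split; apply/allP => i iab; apply: abN; rewrite in_msetD iab ?orbT.
by rewrite in_msetD => /orP[/aN|/bN].
Qed.

Lemma below_seq_mset N (s : seq nat) : below N (seq_mset s) = all (gtn N) s.
Proof. exact/perm_all/perm_eq_seq_mset. Qed.

(* The image of f when all variables x_i with N <= i are set to 0. *)
Definition mtrunc (N : nat) (f : mser) : mser :=
  MSer (fun m => if below N m then mcoef f m else 0).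

Lemma mtrunc_inj (f g : mser) : (forall N, mtrunc N f = mtrunc N g) -> f = g.
Proof.
move=> fg; apply: mserP => m.
have mN : below (\max_(i <- (m : seq nat)) i).+1 m.
  by apply/allP => i im; rewrite /= ltnS; exact: leq_bigmax_seq.
by have := congr1 (mcoef^~ m) (fg (\max_(i <- (m : seq nat)) i).+1); rewrite /= mN.
Qed.

Section Truncation.
Variable N : nat.

Fact mtrunc_is_zmod_morphism : zmod_morphism (mtrunc N).
Proof.
by move=> f g; apply: mserP => m /=; case: ifP => _; rewrite ?subrr.
Qed.

Fact mtrunc_is_monoid_morphism : monoid_morphism (mtrunc N).
Proof.
split=> [|f g]; apply: mserP => m /=.
  case: eqP => [->|_]; last by rewrite if_same.
  by rewrite ifT //; apply/allP => i; rewrite in_mset0.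
rewrite big_seq [RHS]big_seq; case: ifP => mN.
  apply: eq_bigr => a; rewrite mem_msubs => am.
  have := mN; rewrite -{1}(msetBDKC am) below_add => /andP[-> ->] //.
rewrite big1 // => a; rewrite mem_msubs => am.
have := mN; rewrite -{1}(msetBDKC am) below_add.
by case: ifP => _; case: ifP => _; rewrite ?mulr0 ?mul0r.
Qed.

HB.instance Definition _ :=
  GRing.isZmodMorphism.Build mser mser (mtrunc N) mtrunc_is_zmod_morphism.
HB.instance Definition _ :=
  GRing.isMonoidMorphism.Build mser mser (mtrunc N) mtrunc_is_monoid_morphism.

Lemma mtrunc_prod_mvar (s : seq nat) :
  mtrunc N (\prod_(i <- s) mvar i) = if all (gtn N) s then \prod_(i <- s) mvar i else 0.
Proof.
apply: mserP => m; rewrite [LHS]/= coef_prod_mvar; case: eqP => [->|ms].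
  by rewrite below_seq_mset; case: ifP; rewrite // coef_prod_mvar eqxx.
by rewrite if_same; case: ifP => // _; rewrite coef_prod_mvar (introF eqP ms).
Qed.

Lemma mtrunc_msum_prod (I : choiceType) (J : finType) (A : set I) (w : I -> seq nat)
    (Q : pred J) (h : J -> I) :
  set_bij [set` Q] [set i | A i /\ all (gtn N) (w i)] h ->
  mtrunc N (msum A (fun i => \prod_(c <- w i) mvar c))
  = \sum_(j | Q j) \prod_(c <- w (h j)) mvar c.
Proof.
move=> h_bij; have [hQ _ _] := h_bij.
transitivity (\sum_(j | Q j) mtrunc N (\prod_(c <- w (h j)) mvar c)); last first.
  by apply: eq_bigr => j /hQ[_ wN]; rewrite mtrunc_prod_mvar wN.
apply: mserP => m; rewrite mcoef_sum (bigfs _ (index_enum_uniq J)); last first.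
  by move=> j _; rewrite mem_index_enum.
rewrite -(reindex_fsbig _ _ _
  (fun i => mcoef (mtrunc N (\prod_(c <- w i) mvar c)) m) h_bij).
rewrite (fsbig_widen _ A) => [||i [Ai wN]]; last 2 first.
- by move=> i [].
- apply: etrans (congr1 (mcoef^~ m) (mtrunc_prod_mvar _)) _.
  by rewrite ifF //; apply/negP => ?; apply: wN.
by rewrite /=; case: ifP => // _; rewrite fsbig1.
Qed.

Lemma mtrunc_elemsym k :
  mtrunc N (elemsym k) = fin_elemsym (fun i : 'I_N => mvar i) k.
Proof.
pose h (S : {set 'I_N}) : {fset nat} := [fset val i | i in S]%fset.
rewrite /elemsym (mtrunc_msum_prod (J := {set 'I_N}) (h := h) (Q := fun S => #|S| == k)).
  apply: eq_bigr => S _; rewrite /h big_imfset /=; last by move=> i j _ _; exact: val_inj.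
  exact: big_enum.
split=> [S /eqP <- | S T _ _ /fsetP ST | S [Sk /allP SN]] /=.
- split; first by rewrite card_imfset /= -?cardE //; exact: val_inj.
  by apply/allP => i /imfsetP[j _ ->] /=; exact: ltn_ord.
- by apply/setP => i; have := ST (val i); rewrite !(mem_imfset _ _ val_inj).
have hS : h [set i : 'I_N | val i \in S] = S.
  apply/fsetP => i; apply/imfsetP/idP => [[j] |iS]; first by rewrite /= inE => ? ->.
  by exists (Ordinal (SN i iS)); rewrite //= inE.
exists [set i : 'I_N | val i \in S] => //=.
by apply/eqP; rewrite -Sk -[in RHS]hS /h card_imfset /= -?cardE //; exact: val_inj.
Qed.

Lemma mtrunc_chromsym H :
  mtrunc N (chromsym H) = fin_chromsym (fun i : 'I_N => mvar i) H.
Proof.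
pose h (k : {ffun vertex H -> 'I_N}) : {ffun vertex H -> nat} := [ffun u => val (k u)].
have prod_codom (k : {ffun vertex H -> nat}) :
  \prod_u mvar (k u) = \prod_(c <- codom k) mvar c by rewrite big_map big_enum.
rewrite /chromsym (funext prod_codom).
rewrite (mtrunc_msum_prod (h := h) (Q := @is_proper _ H)).
  by apply: eq_bigr => k _; rewrite -prod_codom; apply: eq_bigr => u _; rewrite ffunE.
split=> [k /is_properP kp | k k' _ _ /ffunP kk' | k [kp /allP kN]] /=.
- split=> [u v e|]; first by rewrite !ffunE => /val_inj; exact/eqP/kp.
  by apply/allP => i /codomP[u ->]; rewrite /= ffunE; exact: ltn_ord.
- by apply/ffunP => u; have := kk' u; rewrite !ffunE => /val_inj.
have klt u : (k u < N)%N by exact/kN/codom_f.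
exists [ffun u => Ordinal (klt u)]; last by apply/ffunP => u; rewrite !ffunE.
by apply/is_properP => u v e; rewrite !ffunE -val_eqE /=; apply/eqP/kp.
Qed.

Lemma mtrunc_chromsym_path n :
  mtrunc N (chromsym (path_graph n)) = path_sum (fun i : 'I_N => mvar i) n.
Proof. by rewrite mtrunc_chromsym fin_chromsym_path. Qed.

End Truncation.

(** * Chromatic symmetric functions of twinned paths *)

Lemma elemsym0 : elemsym 0 = 1.
Proof. by apply: mtrunc_inj => N; rewrite mtrunc_elemsym rmorph1 fin_elemsym0. Qed.

Lemma chromsym_path_conv n :
  \sum_(0 <= j < n.+1) (1 - j%:R) * elemsym j * chromsym (path_graph (n - j))
  = elemsym n.
Proof.
apply: mtrunc_inj => N; rewrite rmorph_sum mtrunc_elemsym -path_sum_conv.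
apply: eq_bigr => j _ /=; rewrite !rmorphM rmorphB rmorph1 rmorph_nat /=.
by rewrite mtrunc_elemsym mtrunc_chromsym_path.
Qed.

Local Notation path_twin_form := (twin_form elemsym (fun n => chromsym (path_graph n))).

Lemma chromsym_twinned_path n l : (0 < l <= n)%N ->
  chromsym (twinned_path n l) = path_twin_form l.-1 (n - l).
Proof.
case: l => // a /= an; have {an} [b ->] : exists b, n = (a + b.+1)%N.
  by exists (n - a.+1)%N; lia.
rewrite (_ : a + b.+1 - a.+1 = b)%N; last by lia.
rewrite /twinned_path; case: pickP => [v /eqP[va]|nov]; last first.
  have alt : (a < a + b.+1)%N by rewrite addnS ltnS leq_addr.
  by have := nov (Ordinal alt); rewrite /= eqxx.
apply: mtrunc_inj => N; rewrite mtrunc_chromsym (fin_chromsym_twin_path _ va).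
rewrite /twin_form !(rmorph_nat, rmorphD, rmorphN, rmorphM) /=.
by rewrite !mtrunc_elemsym !mtrunc_chromsym_path.
Qed.

(* Repeated monomials replace nonnegative coefficients, and the factors of a
   monomial need not be sorted. *)
Definition e_nonneg : {pred mser} := fun f =>
  `[< exists2 s : seq (seq nat), all (fun la => 0%N \notin la) s &
      f = \sum_(la <- s) elemsym_part la >].

Lemma e_nonnegP f :
  reflect (exists2 s : seq (seq nat), all (fun la => 0%N \notin la) s &
             f = \sum_(la <- s) elemsym_part la)
    (f \in e_nonneg).
Proof. exact: asboolP. Qed.

Fact e_nonneg_semiring_closed : GRing.semiring_closed e_nonneg.
Proof.
split; split.
- by apply/e_nonnegP; exists [::]; rewrite ?big_nil.
- move=> f g /e_nonnegP[s s0 ->] /e_nonnegP[t t0 ->]; apply/e_nonnegP.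
  by exists (s ++ t); rewrite ?big_cat // all_cat s0.
- by apply/e_nonnegP; exists [:: [::]]; rewrite ?big_seq1 /elemsym_part ?big_nil.
move=> f g /e_nonnegP[s /allP s0 ->] /e_nonnegP[t /allP t0 ->]; apply/e_nonnegP.
exists [seq la ++ mu | la <- s, mu <- t].
  apply/allP => nu /allpairsP[[la mu] /= [las mut ->]].
  by rewrite mem_cat negb_or s0 ?t0.
rewrite big_allpairs_dep big_distrlr; apply: eq_bigr => la _.
by apply: eq_bigr => mu _; rewrite /elemsym_part big_cat.
Qed.

HB.instance Definition _ :=
  GRing.isSemiringClosed.Build mser e_nonneg e_nonneg_semiring_closed.

Lemma elemsym_e_nonneg k : (0 < k)%N -> elemsym k \in e_nonneg.
Proof.
move=> k0; apply/e_nonnegP; exists [:: [:: k]]; rewrite /elemsym_part ?big_seq1 //.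
by rewrite /= inE eq_sym -lt0n k0.
Qed.

Lemma e_nonneg_e_positive f : f \in e_nonneg -> e_positive f.
Proof.
move=> /e_nonnegP[s s0 ->]; pose t := [seq sort geq la | la <- s].
have -> : \sum_(la <- s) elemsym_part la = \sum_(la <- t) elemsym_part la.
  rewrite big_map; apply: eq_bigr => la _.
  by apply: perm_big; rewrite perm_sym perm_sort.
pose c : {fsfun seq nat -> int with 0} :=
  [fsfun la in seq_fset tt t => (count_mem la t)%:Z | 0].
have cE la : c la = (count_mem la t)%:Z.
  by rewrite fsfunE seq_fsetE; case: ifP => // /negbT /count_memPn ->.
have suppE : finsupp c =i undup t.
  move=> la; rewrite mem_finsupp cE mem_undup -has_pred1 has_count.
  by case: (count_mem la t).
exists c; last by move=> la; rewrite cE.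
split=> [la|].
  rewrite suppE mem_undup => /mapP[mu mus ->]; apply/andP; split.
    by apply: sort_sorted => i j; exact: leq_total.
  by rewrite mem_sort; exact: (allP s0).
rewrite -big_undup_iterop_count.
rewrite -(perm_big _ (uniq_perm _ _ suppE)) ?undup_uniq ?fset_uniq //=.
by apply: eq_bigr => la _; rewrite cE -pmulrn mulr_natl.
Qed.

Theorem theorem4p4 :
  (forall n l : nat, (2 <= l)%N -> (l + 1 <= n)%N -> (4 <= n)%N ->
    chromsym (twinned_path n l) =
        \sum_(2 <= j < n - l)
          (j%:R - 1) * elemsym j * chromsym (twinned_path (n - j) l)
      + 4%:R * (n%:R + 1) * elemsym (n + 1)
      + 2%:R * n%:R * elemsym 1 * elemsym n
      + 2%:R * elemsym 1 *
          \sum_(n - l + 2 <= j < n)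
            (j%:R - 1) * elemsym j * chromsym (path_graph (n - j))
      + 4%:R *
          \sum_(n - l + 3 <= j < n + 1)
            (j%:R - 1) * elemsym j * chromsym (path_graph (n + 1 - j))
      + 2%:R *
          \sum_(n - l + 1 <= j < n - l + 3)
            (j%:R - 2%:R) * elemsym j * chromsym (path_graph (n + 1 - j))
      + (n%:R - l%:R - 2%:R) * elemsym (n - l) * chromsym (twinned_path l l))
  /\
  (forall n l : nat, (3 <= n)%N -> (2 <= l)%N -> (l <= n - 1)%N ->
    e_positive (chromsym (twinned_path n l))).
Proof.
have P_conv := chromsym_path_conv; have E0 := elemsym0.
split=> [n l l2 ln _|n l n3 l2 ln]; last first.
  rewrite chromsym_twinned_path; last by lia.
  by apply/e_nonneg_e_positive/(twin_form_mem E0 P_conv elemsym_e_nonneg); lia.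
have twin_shift j : (2 <= j < n - l)%N ->
    (j%:R - 1) * elemsym j * chromsym (twinned_path (n - j) l)
    = (j%:R - 1) * elemsym j * path_twin_form l.-1 (n - l - j).
  by move=> jnl; rewrite chromsym_twinned_path; [congr (_ * twin_form _ _ _ _)|]; lia.
rewrite (eq_big_nat _ _ twin_shift) !chromsym_twinned_path; [|lia..].
rewrite subnn (twin_form_rec E0 P_conv); [|lia..].
have -> : (l.-1 + (n - l)).+1 = n by lia.
by rewrite !addn1 addn2 !addn3 natr1 natrB //; lia.
Qed.
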